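(* For every $c\in(0,1/2)$ and constants $0<c_1\le c_2$ there exist $C>0$ and $n_0$ such that the following holds. Let $m=\lceil c^{-1}+1\rceil$, let $n\ge n_0$ with $m\mid(n-1)$, $D=(n-1)/m$, let $p$ be a prime with $c_1n^c\le p\le c_2n^c$, and $\theta=\pi/p$. Then the state $$|\psi\rangle=\Big(\big(U_{m,\theta}^\dagger\big)^{\otimes D}\otimes e^{-i\pi X/4}\Big)H^{\otimes n}|\mathrm{GHZ}_n\rangle$$ (where $U_{m,\theta}$ is unitary), measured in the computational basis, yields a distribution $P_\psi$ on $\{0,1\}^{n-1}\times\{0,1\}$ with $$\Delta\big(P_\psi,(X,\mathrm{majmod}_p(X)\oplus\mathrm{parity}(X))\big)\le\tfrac12-\tfrac1\pi+\tfrac Cp,$$ $X$ uniform on $\{0,1\}^{n-1}$.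
   Context: $|\mathrm{GHZ}_n\rangle=(|0^n\rangle+|1^n\rangle)/\sqrt2$; $H$ Hadamard; $X$ Pauli-$X$; the $D$ copies of $U_{m,\theta}^\dagger$ act on consecutive blocks of $m$ qubits among the first $n-1$. $M_{m,\theta}|x_1\cdots x_m\rangle=\bigotimes_{j=1}^m e^{-i\theta x_{j-1}X}|x_j\rangle$ (indices mod $m$, $x_0=x_m$). For $x\in\{0,1\}^m$ let $\bar x$ be its complement and $\gamma_x=\langle\bar x|M_{m,\theta}^\dagger M_{m,\theta}|x\rangle$; $U_{m,\theta}|x\rangle=M_{m,\theta}|x\rangle$ if $x_1=0$ and $U_{m,\theta}|x\rangle=(M_{m,\theta}|x\rangle-\gamma_xM_{m,\theta}|\bar x\rangle)/\sqrt{1-|\gamma_x|^2}$ if $x_1=1$. $\mathrm{parity}(x)=|x|\bmod2$; $\mathrm{majmod}_p(x)=0$ if $(|x|\bmod p)<p/2$, else $1$. $\Delta$ is total variation distance. *)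

(* Defs.v *)
From HB Require Import structures.
From mathcomp Require Import all_boot all_order all_algebra.
From mathcomp Require Import all_classical all_reals.
From mathcomp Require Import exp trigo.
From mathcomp Require Import complex.
Set Implicit Arguments. Unset Strict Implicit. Unset Printing Implicit Defensive.
Import Order.TTheory GRing.Theory Num.Theory.
Local Open Scope ring_scope.

Section QDefs.
Variable R : realType.

Definition rC (r : R) : R[i] := Complex r 0.
Definition iC : R[i] := Complex 0 1.
Definition sqnorm (z : R[i]) : R := let: Complex a b := z in a ^+ 2 + b ^+ 2.

(** bit strings {0,1}^k; qubit x_{j+1} of the paper is index j *)
Definition bits k := {ffun 'I_k -> bool}.
Definition bitn k (x : bits k) (i : nat) : bool :=
  if insub i is Some o then x o else false.
Definition weight k (x : bits k) : nat := #|[pred i | x i]|.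
Definition parity k (x : bits k) : bool := odd (weight x).
Definition majmod (p : nat) k (x : bits k) : bool :=
  ~~ (((weight x %% p)%:R : rat) < p%:R / 2).
Definition compl k (x : bits k) : bits k := [ffun i => ~~ x i].

(** an operator on k qubits, given by its matrix entries A y x = <y|A|x> *)
Definition gate k := bits k -> bits k -> R[i].
Definition applyg k (A : gate k) (v : bits k -> R[i]) : bits k -> R[i] :=
  fun y => \sum_x A y x * v x.
Definition adjoint k (A : gate k) : gate k := fun y x => conjc (A x y).
Definition unitary k (A : gate k) : Prop :=
  (forall x x', \sum_y conjc (A y x) * A y x' = (x == x')%:R) /\
  (forall y y', \sum_x A y x * conjc (A y' x) = (y == y')%:R).

(* e^{-i t X} = cos t I - i sin t X *)
Definition expX (t : R) (a b : bool) : R[i] :=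
  if a == b then rC (cos t) else - iC * rC (sin t).
Definition hadamard (a b : bool) : R[i] :=
  rC ((-1) ^+ (a && b) / Num.sqrt 2).
Definition tens1 n (g : bool -> bool -> R[i]) : gate n :=
  fun y x => \prod_i g (y i) (x i).

(** M_{m,theta} |x> = (x) e^{-i theta x_{j-1} X} |x_j>, x_0 = x_m *)
Definition Mgate m (theta : R) : gate m := fun y x =>
  \prod_(j < m) expX (theta * (bitn x ((j + m - 1) %% m) : nat)%:R) (y j) (x j).
Definition gammaU m theta (x : bits m) : R[i] :=
  \sum_y conjc (Mgate theta y (compl x)) * Mgate theta y x.
Definition Ugate m theta : gate m := fun y x =>
  if ~~ bitn x 0 then Mgate theta y x
  else (Mgate theta y x - gammaU theta x * Mgate theta y (compl x))
         / rC (Num.sqrt (1 - sqnorm (gammaU theta x))).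

Definition ghz n (x : bits n) : R[i] :=
  if [forall i, ~~ x i] || [forall i, x i] then rC (1 / Num.sqrt 2) else 0.

(** A^{(x)D} (x) g, where the D copies of A act on consecutive blocks of m
    qubits among the first n-1, and g acts on the last qubit *)
Definition blk m n (x : bits n) (j : nat) : bits m := [ffun k : 'I_m => bitn x (j * m + k)].
Definition blockop n m D (A : gate m) (g : bool -> bool -> R[i]) : gate n :=
  fun y x => (\prod_(j < D) A (blk m y j) (blk m x j)) * g (bitn y n.-1) (bitn x n.-1).

Definition psi n m D (p : nat) : bits n -> R[i] :=
  @applyg n (@blockop n m D (@adjoint m (@Ugate m (pi / p%:R))) (expX (pi / 4)))
         (@applyg n (@tens1 n hadamard) (@ghz n)).

Definition joinb n (x : bits n.-1) (b : bool) : bits n :=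
  [ffun i : 'I_n => if (i < n.-1)%N then bitn x i else b].

Definition Ppsi n m D p (z : bits n.-1 * bool) : R := sqnorm (@psi n m D p (@joinb n z.1 z.2)).
Definition Qtarget n p (z : bits n.-1 * bool) : R :=
  if z.2 == @majmod p n.-1 z.1 (+) @parity n.-1 z.1 then 1 / 2 ^+ n.-1 else 0.

Definition tvdist (T : finType) (P Q : T -> R) : R := 2^-1 * \sum_z `|P z - Q z|.

End QDefs.

(* Main.v *)
Require Import Defs.
From HB Require Import structures.
From mathcomp Require Import all_boot all_order all_algebra.
From mathcomp Require Import all_classical all_reals.
From mathcomp Require Import exp trigo.
From mathcomp Require Import complex.
From mathcomp Require Import topology normedtype sequences derive realfun.
From mathcomp Require Import ring lra zify.
Import Order.TTheory GRing.Theory Num.Theory.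
Import numFieldNormedType.Exports.
Local Open Scope ring_scope.

(** The columns of M are orthonormal up to the overlaps between x and its
    complement, of modulus |sin theta|^m; hence U is unitary and differs from M
    by O(p^-m) in each column. Since <+...+|M|x> and <-...-|M|x> are, up to
    normalisation, exp(-i theta |x|) and (-1)^|x| exp(i theta |x|), replacing
    U by M in the D <= n blocks would make the output exactly
    2^-(n-1) (1 + (-1)^(|x| + b) sin (2 theta |x|)) / 2; as p^(m-1) >= const n,
    the D block errors add up to O(1/p). The distance of this ideal
    distribution to the target is 1/2 - E[s(|X|)] / 2, with s(w) the sine of
    2 pi w / p signed by majmod. Finally E[s(|X|)] is the value at 0 of the
    (n-1)-fold iterate of F |-> (F(w) + F(w+1)) / 2 on p-periodic functions,
    which by a Poincare inequality contracts mean-zero functions by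
    1 - 1/(4 p^2) in squared norm; since p = O(n^c) with c < 1/2, this is
    within O(1/p) of the mean of s over one period, which telescopes to
    (1 + cos (pi/p)) / (p sin (pi/p)) >= 2/pi - 1/p. *)

(** * Equidistribution of the Hamming weight modulo p *)

Section Averaging.
Set Implicit Arguments. Unset Strict Implicit. Unset Printing Implicit Defensive.
Variable R : realType.
Implicit Types (F : nat -> R) (p N : nat).

(** Conditional expectation of [F] once one more uniform bit is added to the weight [w]. *)
Definition avg F : nat -> R := fun w => (F w + F w.+1) / 2.

Lemma sqr_sum_le (a : nat -> R) r :
  (\sum_(i < r) a i) ^+ 2 <= r%:R * \sum_(i < r) a i ^+ 2.
Proof.
elim: r => [|r IH]; first by rewrite !big_ord0 expr0n mul0r.
rewrite !big_ord_recr /= -natr1.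
set S := \sum_(i < r) a i in IH *; set Q := \sum_(i < r) a i ^+ 2 in IH *.
have [r0|r0] := posnP r.
  have S0 : S = 0 by rewrite /S r0 big_ord0.
  have Q0 : Q = 0 by rewrite /Q r0 big_ord0.
  by rewrite S0 Q0 r0 !add0r mul1r.
have rp : 0 < r%:R :> R by rewrite ltr0n.
suff : 2 * S * a r <= Q + r%:R * a r ^+ 2 by nra.
(* Multiplied by [r], the claim follows from [S ^+ 2 <= r * Q] and the square of [S - r * a r]. *)
rewrite -(ler_pM2l rp).
have := sqr_ge0 (S - r%:R * a r); nra.
Qed.

Section Periodic.
Variable p : nat.
Hypothesis p_gt0 : (0 < p)%N.

Definition periodicn F := forall w, F (w + p)%N = F w.

Lemma sum_shift F : periodicn F -> \sum_(r < p) F r.+1 = \sum_(r < p) F r.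
Proof.
move=> Fp; apply/eqP; rewrite -subr_eq0 -sumrB.
rewrite -(big_mkord xpredT (fun r => F r.+1 - F r)) telescope_sumr //.
by rewrite -[p]add0n Fp subrr.
Qed.

Lemma avg_periodic F : periodicn F -> periodicn (avg F).
Proof. by move=> Fp w; rewrite /avg -addSn !Fp. Qed.

Lemma sum_avg F : periodicn F -> \sum_(r < p) avg F r = \sum_(r < p) F r.
Proof.
move=> Fp; rewrite /avg -mulr_suml big_split /= sum_shift //.
by field.
Qed.

(** Each [F r - F 0] is a sum of at most [p] increments, so Cauchy-Schwarz costs one factor [p], and
    summing over [r] costs the other. *)
Lemma poincare F : \sum_(r < p) F r = 0 ->
  \sum_(r < p) F r ^+ 2 <= p%:R ^+ 2 * \sum_(r < p) (F r.+1 - F r) ^+ 2.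
Proof.
move=> F0; set Q := \sum_(r < p) (F r.+1 - F r) ^+ 2.
(* The mean, here 0, minimises the quadratic deviation. *)
apply: (@le_trans _ _ (\sum_(r < p) (F r - F 0%N) ^+ 2)).
  have -> : \sum_(r < p) (F r - F 0%N) ^+ 2 =
     \sum_(r < p) F r ^+ 2 - 2 * F 0%N * \sum_(r < p) F r + F 0%N ^+ 2 *+ p.
    have -> : F 0%N ^+ 2 *+ p = \sum_(r < p) F 0%N ^+ 2.
      by rewrite sumr_const card_ord.
    rewrite mulr_sumr -sumrB -big_split /=.
    by apply: eq_bigr => r _; ring.
  by rewrite F0 mulr0 subr0 lerDl mulrn_wge0 // sqr_ge0.
have le r : (r < p)%N -> (F r - F 0%N) ^+ 2 <= p%:R * Q.
  move=> rp; rewrite -(telescope_sumr F (leq0n r)) big_mkord.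
  apply: le_trans (sqr_sum_le (fun i => F i.+1 - F i) r) _.
  apply: ler_pM => //.
  - by apply: sumr_ge0 => i _; exact: sqr_ge0.
  - by rewrite ler_nat ltnW.
  - rewrite /Q -(big_mkord xpredT (fun i => (F i.+1 - F i) ^+ 2)).
    rewrite -(big_mkord xpredT (fun i => (F i.+1 - F i) ^+ 2)).
    rewrite [leRHS](@big_cat_nat _ _ _ r) //=; last exact: ltnW.
    by rewrite lerDl sumr_ge0 // => i _; exact: sqr_ge0.
have -> : p%:R ^+ 2 * Q = \sum_(r < p) p%:R * Q.
  by rewrite sumr_const card_ord -[RHS]mulr_natl mulrA expr2.
by apply: ler_sum => r _; exact: le.
Qed.

Definition energy F := \sum_(r < p) F r ^+ 2.

(** By the parallelogram law, averaging loses exactly a quarter of the sum of squared increments,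
    which [poincare] bounds below by the energy. *)
Lemma energy_avg F : periodicn F -> \sum_(r < p) F r = 0 ->
  energy (avg F) <= (1 - (4 * p%:R ^+ 2)^-1) * energy F.
Proof.
move=> Fp F0.
have pp : 0 < p%:R ^+ 2 :> R by rewrite exprn_gt0 // ltr0n.
have -> : energy (avg F) =
    energy F - 4^-1 * \sum_(r < p) (F r.+1 - F r) ^+ 2.
  have -> : energy F = 2^-1 * energy F + 2^-1 * \sum_(r < p) F r.+1 ^+ 2.
    rewrite (@sum_shift (fun r => F r ^+ 2)); last by move=> w; rewrite Fp.
    by rewrite -/(energy F); field.
  rewrite /energy !mulr_sumr -big_split -sumrB /=.
  by apply: eq_bigr => r _; rewrite /avg; field.
have := poincare F0; rewrite -/(energy F).
set Q := \sum_(r < p) _; move=> le.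
rewrite mulrBl mul1r lerD2l lerN2 invfM -mulrA ler_pM2l ?invr_gt0 //.
by rewrite mulrC ler_pdivrMr // mulrC.
Qed.

Lemma iter_avg_periodic N F : periodicn F -> periodicn (iter N avg F).
Proof. by move=> Fp; elim: N => //= N; exact: avg_periodic. Qed.

Lemma sum_iter_avg N F : periodicn F ->
  \sum_(r < p) iter N avg F r = \sum_(r < p) F r.
Proof.
by move=> Fp; elim: N => //= N IH; rewrite sum_avg //; exact: iter_avg_periodic.
Qed.

Lemma energy_iter_avg N F : periodicn F -> \sum_(r < p) F r = 0 ->
  energy (iter N avg F) <= (1 - (4 * p%:R ^+ 2)^-1) ^+ N * energy F.
Proof.
move=> Fp F0; elim: N => [|N IH]; first by rewrite expr0 mul1r.
have pp : 1 <= p%:R ^+ 2 :> R by rewrite exprn_ege1 // ler1n.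
rewrite iterS exprS -mulrA.
apply: le_trans (energy_avg _ _) _.
- exact: iter_avg_periodic.
- by rewrite sum_iter_avg.
- apply: ler_wpM2l IH; rewrite subr_ge0 invf_le1; lra.
Qed.

End Periodic.

Definition headb k (b : bool) (x : bits k) : bits k.+1 :=
  [ffun i => if unlift ord0 i is Some j then x j else b].

Lemma weightE k (x : bits k) : weight x = (\sum_(i < k) x i)%N.
Proof.
rewrite /weight -sum1_card big_mkcond.
by apply: eq_bigr => i _; rewrite inE; case: (x i).
Qed.

Lemma weight_headb k b (x : bits k) : weight (headb b x) = (b + weight x)%N.
Proof.
rewrite !weightE big_ord_recl ffunE unlift_none; congr addn.
by apply: eq_bigr => i _; rewrite ffunE liftK.
Qed.

Lemma sum_bitsS (V : zmodType) k (G : bits k.+1 -> V) :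
  \sum_x G x = \sum_x G (headb false x) + \sum_x G (headb true x).
Proof.
rewrite (reindex (fun z : bool * bits k => headb z.1 z.2)) /=; last first.
  exists (fun x : bits k.+1 => (x ord0, [ffun j => x (lift ord0 j)])).
    move=> [b x] _ /=; rewrite ffunE unlift_none; congr pair.
    by apply/ffunP => j; rewrite !ffunE liftK.
  move=> x _ /=; apply/ffunP => i; rewrite ffunE.
  by case: unliftP => [j ->|->]; rewrite ?ffunE.
rewrite -(pair_bigA _ (fun b x => G (headb b x))) /= big_bool addrC //.
Qed.

Lemma avg_shift N F w : iter N avg F w.+1 = iter N avg (F \o S) w.
Proof. by elim: N w => //= N IH w; rewrite /avg !IH. Qed.

(** Splitting off the first bit replaces [F] by [F] and its shift; since the shift commutes with
    [avg], the extra average can be taken last. *)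
Lemma mean_weight N F :
  \sum_(x : bits N) F (weight x) = 2 ^+ N * iter N avg F 0%N.
Proof.
elim: N F => [|N IH] F.
  rewrite expr0 mul1r /= (bigD1 [ffun=> false]) //= big1 ?addr0.
    by rewrite weightE big_ord0.
  by move=> x /eqP[]; apply/ffunP => -[].
rewrite sum_bitsS.
under eq_bigr do rewrite weight_headb add0n.
under [in X in _ + X]eq_bigr do rewrite weight_headb add1n.
rewrite IH (IH (F \o S)) iterS {3}/avg avg_shift exprS; field; rewrite ?pnatr_eq0 //.
Qed.

(** The centred function [G] has energy at most [p * (2 * M) ^+ 2], which contracts at each of the
    [N] steps; the squared value at 0 is a single term of the final energy. *)
Lemma mean_weight_close p N F M : (0 < p)%N -> periodicn p F ->
  (forall w, `|F w| <= M) ->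
  (2 ^- N * \sum_(x : bits N) F (weight x) - p%:R^-1 * \sum_(r < p) F r) ^+ 2
    <= (1 - (4 * p%:R ^+ 2)^-1) ^+ N * (4 * M ^+ 2 * p%:R).
Proof.
move=> p0 Fp FM.
have pp : 0 < p%:R :> R by rewrite ltr0n.
have pp2 : 1 <= p%:R ^+ 2 :> R by rewrite exprn_ege1 // ler1n.
have M0 : 0 <= M by apply: le_trans (FM 0%N).
set mu := p%:R^-1 * _; pose G w := F w - mu.
have muM : `|mu| <= M.
  rewrite normrM ger0_norm ?invr_ge0 ?(ltW pp) // ler_pdivrMl //.
  apply: le_trans (ler_norm_sum _ _ _) _.
  apply: (@le_trans _ _ (\sum_(r < p) M)); first exact: ler_sum.
  by rewrite sumr_const card_ord mulr_natl.
have GE : 2 ^- N * \sum_(x : bits N) F (weight x) - mu = iter N avg G 0%N.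
  have : \sum_(x : bits N) G (weight x) = 2 ^+ N * iter N avg G 0%N.
    exact: mean_weight.
  rewrite sumrB sumr_const card_ffun card_bool card_ord => h.
  apply: (@mulfI _ (2 ^+ N)); first by rewrite expf_neq0 // pnatr_eq0.
  rewrite -h mulrBr mulrA divff ?expf_neq0 ?pnatr_eq0 // mul1r.
  by rewrite -[mu *+ _]mulr_natl natrX.
have Gp : periodicn p G by move=> w; rewrite /G Fp.
have G0 : \sum_(r < p) G r = 0.
  rewrite sumrB sumr_const card_ord -mulr_natl /mu mulrA divff ?gt_eqF //.
  by rewrite mul1r subrr.
rewrite GE.
have : energy p (iter N avg G) <= (1 - (4 * p%:R ^+ 2)^-1) ^+ N * energy p G.
  exact: energy_iter_avg.
have E1 : iter N avg G 0%N ^+ 2 <= energy p (iter N avg G).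
  rewrite /energy (bigD1 (Ordinal p0)) //= lerDl sumr_ge0 // => i _.
  exact: sqr_ge0.
have E2 : energy p G <= 4 * M ^+ 2 * p%:R.
  apply: (@le_trans _ _ (\sum_(r < p) 4 * M ^+ 2)); last first.
    by rewrite sumr_const card_ord mulr_natr.
  apply: ler_sum => r _; rewrite /G -real_normK ?num_real //.
  have : `|F r - mu| <= M + M.
    by apply: le_trans (ler_normB _ _) _; rewrite lerD.
  have := normr_ge0 (F r - mu); nra.
move=> E3; apply: le_trans E1 (le_trans E3 _).
apply: ler_wpM2l E2; apply: exprn_ge0; rewrite subr_ge0 invf_le1; lra.
Qed.

End Averaging.

(** * The mean of the signed sine *)

Section SignedSine.
Set Implicit Arguments. Unset Strict Implicit. Unset Printing Implicit Defensive.
Variable R : realType.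

Lemma sin_le_id (x : R) : 0 <= x -> sin x <= x.
Proof.
rewrite le_eqVlt => /predU1P[<-|x0]; first by rewrite sin0.
pose f (y : R) := y - sin y.
have df (y : R) : is_derive y 1 f (1 - cos y) by apply: is_deriveB.
have cf : {within `[0, x], continuous f}%classic.
  by apply: derivable_within_continuous => y _; case: (df y).
have [y _] := MVT x0 (fun y _ => df y) cf.
rewrite /f sin0 !subr0 => e.
by rewrite -subr_ge0 e mulr_ge0 ?(ltW x0) // subr_ge0 cos_le1.
Qed.

(** The half-angle formula gives [cos x >= 1 - x ^+ 2 / 2], and [x ^+ 2 / 2 <= x] on this
    interval. *)
Lemma cos_ge1B (x : R) : 0 <= x <= 2 -> 1 - x <= cos x.
Proof.
move=> /andP[x0 x2]; have -> : cos x = cos ((x / 2) *+ 2).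
  by congr cos; rewrite -mulr_natr; field.
rewrite cos_mulr2n cos2sin2 -mulr_natr.
have y0 : 0 <= x / 2 by rewrite divr_ge0.
have s0 : 0 <= sin (x / 2).
  by apply: sin_ge0_pi; rewrite y0 /=; have := pi_ge2 R; lra.
have := sin_le_id y0; nra.
Qed.

Definition majmodn p (w : nat) : bool := ~~ (((w %% p)%:R : rat) < p%:R / 2).

(** For positive [p] this is the absolute value of the sine; the sign is kept in [majmodn] form to
    match the target bit. *)
Definition signed_sin p (w : nat) : R :=
  (-1) ^+ majmodn p w * sin (2 * (pi / p%:R) * w%:R).

Lemma signed_sin_periodic p : (0 < p)%N -> periodicn p (signed_sin p).
Proof.
move=> p0 w; rewrite /signed_sin /majmodn modnDr; congr (_ * _).
rewrite -[RHS]sinD2pi; congr sin.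
by rewrite natrD -[pi *+ 2]mulr_natr; field; rewrite pnatr_eq0 -lt0n.
Qed.

Lemma signed_sin_max p w : `|signed_sin p w| <= 1.
Proof. by rewrite normrM normrX normrN1 expr1n mul1r sin_max. Qed.

(** Product-to-sum turns each term into a difference of cosines at [(2r-1)x] and [(2r+1)x], so the
    sum telescopes. *)
Lemma sum_sin (x : R) a b : (a <= b)%N ->
  2 * sin x * \sum_(a <= r < b) sin (2 * x * r%:R) =
  cos ((2 * a%:R - 1) * x) - cos ((2 * b%:R - 1) * x).
Proof.
move=> ab; rewrite mulr_sumr.
rewrite -opprB -(telescope_sumr (fun r => cos ((2 * r%:R - 1) * x)) ab) -sumrN.
apply: eq_bigr => r _.
have -> : (2 * r.+1%:R - 1) * x = 2 * x * r%:R + x by rewrite -[r.+1%:R]natr1; ring.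
have -> : (2 * r%:R - 1) * x = 2 * x * r%:R - x by ring.
rewrite cosD cosB; ring.
Qed.

(** The sign flips at [h = (p+1)/2]. The telescoped angles at 0, [h] and [p] are [-x], [pi] and
    [2 pi - x], so each half contributes [1 + cos x] to twice the left side. *)
Lemma sum_signed_sin p : odd p -> (2 < p)%N ->
  sin (pi / p%:R) * \sum_(r < p) signed_sin p r = 1 + cos (pi / p%:R).
Proof.
move=> op p2; set x := pi / p%:R.
have pn0 : p%:R != 0 :> R by rewrite pnatr_eq0; lia.
pose h := (p.+1)./2.
have hp : (h <= p)%N by rewrite /h; lia.
have hE : (2 * h = p.+1)%N by rewrite /h; lia.
have lo r : (r < h)%N -> signed_sin p r = sin (2 * x * r%:R).
  move=> rh; rewrite /signed_sin /majmodn modn_small; last by lia.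
  rewrite (_ : _ < _) ?expr0 ?mul1r // ltr_pdivlMr // -natrM ltr_nat; lia.
have hi r : (h <= r < p)%N -> signed_sin p r = - sin (2 * x * r%:R).
  move=> /andP[hr rp]; rewrite /signed_sin /majmodn modn_small //.
  rewrite -leNgt (_ : _ <= _) ?expr1 ?mulN1r //.
  rewrite ler_pdivrMr // -natrM ler_nat; lia.
rewrite -(big_mkord xpredT (signed_sin p)) (@big_cat_nat _ _ _ h) //=.
rewrite (eq_big_nat _ _ (F2 := fun r => sin (2 * x * r%:R))); last first.
  by move=> r /andP[_ rh]; exact: lo.
rewrite [X in _ + X](eq_big_nat _ _ (F2 := fun r => - sin (2 * x * r%:R))) //.
rewrite sumrN.
have := @sum_sin x 0 h (leq0n _); have := sum_sin x hp.
have -> : (2 * 0%:R - 1) * x = - x by ring.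
have -> : (2 * h%:R - 1) * x = pi.
  by rewrite -natrM hE -natr1 addrK /x mulrC mulfVK.
have -> : (2 * p%:R - 1) * x = - x + pi *+ 2.
  by rewrite /x -mulr_natr; field.
rewrite cosD2pi cosN cospi; lra.
Qed.

(** From [sin x <= x] and [cos x >= 1 - x] one gets [x * S >= 2 - x]; dividing by [x * p = pi] gives
    the bound. *)
Lemma mean_signed_sin_ge p : odd p -> (2 < p)%N ->
  2 / pi - p%:R^-1 <= p%:R^-1 * \sum_(r < p) signed_sin p r.
Proof.
move=> op p2; have := sum_signed_sin op p2.
set x := pi / p%:R; set S := \sum_(r < p) _ => sS.
have p3 : 3 <= p%:R :> R by rewrite ler_nat.
have pi0 := pi_gt0 R; have pi4 : pi < 4 :> R by have := pihalf_lt2 R; lra.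
have x0 : 0 < x by rewrite divr_gt0 //; lra.
have x2 : x <= 2 by rewrite ler_pdivrMr; lra.
have s0 : 0 < sin x.
  by apply: sin_gt0_pi; rewrite x0 /=; have := pi_ge2 R; rewrite ltr_pdivrMr; nra.
have c0 : 1 - x <= cos x by apply: cos_ge1B; rewrite (ltW x0).
have sx := sin_le_id (ltW x0).
have S0 : 0 <= S by nra.
have xS : 2 - x <= x * S by nra.
rewrite -(ler_pM2l x0).
have -> : x * (p%:R^-1 * S) = p%:R^-1 * (x * S) by ring.
have -> : x * (2 / pi - p%:R^-1) = p%:R^-1 * (2 - x).
  by rewrite /x; field; rewrite !gt_eqF //; lra.
by rewrite ler_pM2l // invr_gt0; lra.
Qed.

End SignedSine.

(** * The Gram matrix of M and unitarity of U *)

Section Gram.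
Set Implicit Arguments. Unset Strict Implicit. Unset Printing Implicit Defensive.
Variable R : realType.
Implicit Types (t th : R).

Lemma complexP (z z' : R[i]) :
  complex.Re z = complex.Re z' -> complex.Im z = complex.Im z' -> z = z'.
Proof. by case: z => a b; case: z' => a' b' /= -> ->. Qed.

Lemma rCD (a b : R) : rC (a + b) = rC a + rC b.
Proof. exact: (rmorphD (real_complex R)). Qed.

Lemma rCB (a b : R) : rC (a - b) = rC a - rC b.
Proof. exact: (rmorphB (real_complex R)). Qed.

Lemma rCM (a b : R) : rC (a * b) = rC a * rC b.
Proof. exact: (rmorphM (real_complex R)). Qed.

Lemma rCX (a : R) k : rC (a ^+ k) = rC a ^+ k.
Proof. exact: (rmorphXn (real_complex R)). Qed.

Lemma sqnormE (z : R[i]) : rC (sqnorm z) = `|z| ^+ 2.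
Proof.
case: z => a b; rewrite normc_def /= -[(_)%:C%C]/(rC _) -rCX sqr_sqrtr //.
by rewrite addr_ge0 ?sqr_ge0.
Qed.

Lemma conjc_rC (a : R) : conjc (rC a) = rC a.
Proof. exact: conjc_real. Qed.

Lemma conjc_div_rC (a b g : R[i]) (s : R) :
  conjc ((a - g * b) / rC s) = (conjc a - conjc g * conjc b) / rC s.
Proof.
rewrite [LHS](rmorphM (@conjc R)) (rmorphB (@conjc R)) (rmorphM (@conjc R)).
by congr (_ * _); rewrite [LHS]conjc_inv conjc_rC.
Qed.

Lemma expX_gram (s t : R) a b :
  \sum_c conjc (expX s c a) * expX t c b = expX (t - s) a b.
Proof.
rewrite big_bool /expX /iC /rC.
by case: a; case: b => /=; apply: complexP; simpc; rewrite /= ?cosB ?sinB; ring.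
Qed.

Lemma expX0 a b : expX (0 : R) a b = (a == b)%:R.
Proof.
by rewrite /expX cos0 sin0; case: eqP => // _; apply: complexP; rewrite /iC /rC; simpc.
Qed.

Lemma bitn_ord m (x : bits m) (j : 'I_m) : bitn x j = x j.
Proof. by rewrite /bitn valK. Qed.

Lemma MgateE m th (y x : bits m) :
  Mgate th y x =
  \prod_(j < m) expX (th * (x (ord_pred j) : nat)%:R) (y j) (x j).
Proof. by apply: eq_bigr => j _; rewrite subn1 -(bitn_ord x (ord_pred j)). Qed.

Definition gramM m th (y x : bits m) : R[i] :=
  \sum_u conjc (Mgate th u y) * Mgate th u x.

(** Each column of M is a product vector, so an overlap of two columns factors into single-qubit
    overlaps, where the rotation angles subtract. *)
Lemma gramME m th (y x : bits m) : gramM th y x =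
  \prod_(j < m) expX (th * (x (ord_pred j) : nat)%:R
                      - th * (y (ord_pred j) : nat)%:R) (y j) (x j).
Proof.
rewrite /gramM; under eq_bigr do rewrite !MgateE rmorph_prod -big_split /=.
under [RHS]eq_bigr do rewrite -expX_gram.
by rewrite bigA_distr_bigA.
Qed.

Lemma gramM_diag m th (x : bits m) : gramM th x x = 1.
Proof. by rewrite gramME big1 // => j _; rewrite subrr expX0 eqxx. Qed.

Lemma gramM_conj m th (y x : bits m) : conjc (gramM th y x) = gramM th x y.
Proof.
rewrite /gramM rmorph_sum; apply: eq_bigr => u _.
by rewrite rmorphM /= conjcK mulrC.
Qed.

(* If x and y agree at some index but not everywhere, then going around the
   cycle there is an index where they differ just after one where they agree;
   there the factor is a vanishing sine. *)
Lemma gramM_eq0 m th (y x : bits m) : y != x -> y != compl x ->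
  gramM th y x = 0.
Proof.
move=> yx yc; rewrite gramME; apply/eqP; apply/prodf_eq0.
have [j0 d0] : exists j, y j == x j.
  apply/existsP; rewrite -[X in is_true X]negbK negb_exists; apply/negP => /forallP h.
  case/eqP: yc; apply/ffunP => j; rewrite ffunE.
  by have := h j; case: (y j) (x j) => [] [].
suff [j /andP[e d]] : exists j, (y (ord_pred j) == x (ord_pred j)) && (y j != x j).
  by exists j => //; rewrite (eqP e) subrr expX0 (negbTE d).
apply/existsP; rewrite -[X in is_true X]negbK negb_exists; apply/negP => /forallP h.
case/eqP: yx; apply/ffunP => j; apply/eqP.
have step i : y i == x i -> y (ordS i) == x (ordS i).
  by have := h (ordS i); rewrite ordSK negb_and negbK; case: (y i == x i).
have it k : y (iter k (@ordS m) j0) == x (iter k (@ordS m) j0).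
  by elim: k => //= k; exact: step.
have itE k : iter k (@ordS m) j0 = ((j0 + k) %% m)%N :> nat.
  elim: k => [|k IH]; first by rewrite addn0 modn_small.
  by rewrite iterS /= IH -addn1 modnDml addn1 addnS.
(* The extra turn [m] keeps the subtraction from truncating when [j < j0]. *)
suff -> : j = iter (j + m - j0) (@ordS m) j0 by [].
apply: ord_inj; rewrite itE addnC subnK ?modnDr ?modn_small //.
exact: leq_trans (ltnW (ltn_ord j0)) (leq_addl _ _).
Qed.

Lemma complK m : involutive (@compl m).
Proof. by move=> x; apply/ffunP => i; rewrite !ffunE negbK. Qed.

(** For complementary strings all target bits and all control bits differ, so every factor is an
    off-diagonal entry at angle [th] or [- th]. *)
Lemma norm_gammaU m th (x : bits m) : `|gammaU th x| = rC (`|sin th| ^+ m).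
Proof.
rewrite /gammaU -/(gramM th (compl x) x) gramME normr_prod.
transitivity (\prod_(j < m) rC `|sin th|); last first.
  by rewrite prodr_const card_ord rCX.
apply: eq_bigr => j _; rewrite !ffunE /expX.
rewrite -[X in if X then _ else _]negbK eq_sym; case: (x j) => /=.
all: rewrite normrM normrN.
all: have -> : `|iC R| = 1 by rewrite normc_def /= expr0n expr1n add0r sqrtr1.
all: rewrite mul1r normc_def /= expr0n addr0 sqrtr_sqr; congr rC.
all: case: (x (ord_pred j)) => /=; rewrite ?mulr1 ?mulr0 ?subr0 ?sub0r //.
all: by rewrite sinN normrN.
Qed.

Lemma sqnorm_gammaU m th (x : bits m) :
  sqnorm (gammaU th x) = (`|sin th| ^+ m) ^+ 2.
Proof.
suff : rC (sqnorm (gammaU th x)) = rC ((`|sin th| ^+ m) ^+ 2) by case.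
by rewrite sqnormE norm_gammaU -rCX.
Qed.

(** In finite dimension a left inverse is a right inverse; bit strings are enumerated in order to
    apply this to square matrices. *)
Lemma unitary_of_isometry m (A : gate R m) :
  (forall x x', \sum_y conjc (A y x) * A y x' = (x == x')%:R) -> unitary A.
Proof.
move=> iso; split => // y y'.
pose B := \matrix_(i < #|bits m|, j < #|bits m|) A (enum_val i) (enum_val j).
pose B' := \matrix_(i < #|bits m|, j < #|bits m|) conjc (A (enum_val j) (enum_val i)).
have : B' *m B = 1%:M.
  apply/matrixP => i j; rewrite !mxE -(inj_eq enum_val_inj) -iso.
  rewrite [RHS](reindex_onto enum_val enum_rank) /=; last by move=> *; rewrite enum_rankK.
  apply: eq_big => k; first by rewrite enum_valK eqxx.
  by rewrite !mxE.
move/mulmx1C => /matrixP /(_ (enum_rank y) (enum_rank y')).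
rewrite !mxE (inj_eq enum_rank_inj) => <-.
rewrite (reindex_onto enum_val enum_rank) /=; last by move=> *; rewrite enum_rankK.
apply: eq_big => k; first by rewrite enum_valK eqxx.
by rewrite !mxE !enum_rankK.
Qed.

Lemma bitn_compl m (x : bits m) : (0 < m)%N -> bitn (compl x) 0 = ~~ bitn x 0.
Proof.
move=> m0; rewrite -[0%N]/(nat_of_ord (Ordinal m0)) !bitn_ord; exact: ffunE.
Qed.

(** U is Gram-Schmidt inside each pair of complementary strings, and different pairs are already
    orthogonal. The bound on the sine makes the normalising root nonzero. The cases follow the first
    bits of [x] and [x']. *)
Lemma Ugate_unitary m th : (0 < m)%N -> `|sin th| < 1 -> unitary (@Ugate R m th).
Proof.
move=> m0 sin1; apply: unitary_of_isometry => x x'.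
pose r v := Num.sqrt (1 - sqnorm (@gammaU R m th v)).
have rn0 v : rC (r v) != 0.
  have : 0 < r v.
    by rewrite sqrtr_gt0 subr_gt0 sqnorm_gammaU -exprM exprn_ilt1 // -lt0n muln_gt0 m0.
  by move=> h; rewrite (_ : 0 = rC 0) // (inj_eq (@complexI R)) gt_eqF.
have gam v : gammaU th v = gramM th (compl v) v by [].
have gam' v : gramM th v (compl v) = conjc (gammaU th v) by rewrite gam gramM_conj.
have Gneq := @gramM_eq0 m th.
have ne (a b : bits m) : bitn a 0 != bitn b 0 -> (a == b) = false.
  by move=> h; apply/eqP => e; rewrite e eqxx in h.
rewrite /Ugate -/(r x) -/(r x').
case bx: (bitn x 0); case bx': (bitn x' 0) => /=; last first.
- rewrite -/(gramM th x x'); have [->|nx] := eqVneq x x'; first exact: gramM_diag.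
  apply: Gneq => //; apply/negbT/ne; rewrite bitn_compl // bx bx' //.
- transitivity ((gramM th x x' - gammaU th x' * gramM th x (compl x')) / rC (r x')).
    rewrite /gramM mulr_sumr -sumrB mulr_suml; apply: eq_bigr => u _; ring.
  have xx' : x != x' by apply/negbT/ne; rewrite bx bx'.
  rewrite (negbTE xx'); have [->|xc] := eqVneq x (compl x').
    by rewrite gramM_diag mulr1 -gam subrr mul0r.
  by rewrite !Gneq ?mulr0 ?subrr ?mul0r ?complK.
- transitivity ((gramM th x x' - conjc (gammaU th x) * gramM th (compl x) x') / rC (r x)).
    rewrite /gramM mulr_sumr -sumrB mulr_suml; apply: eq_bigr => u _.
    by rewrite conjc_div_rC; ring.
  have xx' : x != x' by apply/negbT/ne; rewrite bx bx'.
  rewrite (negbTE xx'); have [<-|xc] := eqVneq (compl x) x'.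
    by rewrite gramM_diag mulr1 gam' subrr mul0r.
  rewrite !Gneq ?mulr0 ?subrr ?mul0r ?(inj_eq (inv_inj (@complK m))) //.
  by apply: contra xc => /eqP ->; rewrite complK.
- transitivity ((gramM th x x' - gammaU th x' * gramM th x (compl x')
      - conjc (gammaU th x) * gramM th (compl x) x'
      + conjc (gammaU th x) * (gammaU th x' * gramM th (compl x) (compl x')))
      / rC (r x) / rC (r x')).
    rewrite /gramM !mulr_sumr -!sumrB -big_split /= !mulr_suml.
    apply: eq_bigr => u _.
    by rewrite conjc_div_rC; ring.
  have xc : x != compl x' by apply/negbT/ne; rewrite bitn_compl // bx bx'.
  have [<-|xx'] := eqVneq x x'; last first.
    have xc' : compl x != x' by apply: contra xc => /eqP <-; rewrite complK.
    rewrite !Gneq ?complK ?(inj_eq (inv_inj (@complK m))) //.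
    by rewrite !mulr0 !subr0 addr0 !mul0r.
  rewrite !gramM_diag gam' -gam.
  (* The squared norm before normalisation is [1 - |gamma|^2], which cancels the two roots. *)
  have -> : 1 - gammaU th x * conjc (gammaU th x)
     - conjc (gammaU th x) * gammaU th x + conjc (gammaU th x) * (gammaU th x * 1)
     = rC (r x) * rC (r x).
    rewrite mulr1 subrK -sqr_normc -sqnormE.
    rewrite -rCM -expr2 sqr_sqrtr; last first.
      by rewrite subr_ge0 sqnorm_gammaU -exprM exprn_ile1 // ltW.
    by rewrite rCB.
  by rewrite mulfK // divff.
Qed.

End Gram.

(** * Amplitudes of one block *)

Section Amplitude.
Set Implicit Arguments. Unset Strict Implicit. Unset Printing Implicit Defensive.
Variable R : realType.
Implicit Types (t th : R) (z : R[i]).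

Definition cnorm z : R := Num.sqrt (sqnorm z).

Lemma cnormE z : `|z| = rC (cnorm z).
Proof. by case: z => a b; rewrite normc_def. Qed.

Lemma cnorm_ge0 z : 0 <= cnorm z. Proof. exact: sqrtr_ge0. Qed.

Lemma cnorm_sqr z : sqnorm z = cnorm z ^+ 2.
Proof. by rewrite sqr_sqrtr //; case: z => a b; rewrite addr_ge0 ?sqr_ge0. Qed.

Lemma rC_inj : injective (@rC R). Proof. exact: complexI. Qed.

Lemma cnormM z z' : cnorm (z * z') = cnorm z * cnorm z'.
Proof. by apply: rC_inj; rewrite rCM -!cnormE normrM. Qed.

Lemma cnormD z z' : cnorm (z + z') <= cnorm z + cnorm z'.
Proof.
suff : rC (cnorm (z + z')) <= rC (cnorm z + cnorm z') by rewrite lecR.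
by rewrite rCD -!cnormE ler_normD.
Qed.

Lemma cnormN z : cnorm (- z) = cnorm z.
Proof. by apply: rC_inj; rewrite -!cnormE normrN. Qed.

Lemma cnormJ z : cnorm (conjc z) = cnorm z.
Proof. by case: z => a b; rewrite /cnorm /= sqrrN. Qed.

Lemma cnorm_rC (a : R) : cnorm (rC a) = `|a|.
Proof. by rewrite /cnorm /= expr0n addr0 sqrtr_sqr. Qed.

Lemma cnorm1 : cnorm 1 = 1.
Proof. by rewrite -[1]/(rC 1) cnorm_rC normr1. Qed.

Lemma cnorm_sign (e : nat) : cnorm ((-1) ^+ e) = 1.
Proof.
by elim: e => [|e IH]; rewrite ?expr0 ?cnorm1 // exprS cnormM IH cnormN cnorm1 mulr1.
Qed.

Lemma cnorm_prod1 (I : finType) (u : I -> R[i]) :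
  (forall i, cnorm (u i) = 1) -> cnorm (\prod_i u i) = 1.
Proof.
move=> u1; elim/big_ind: _ => //; first exact: cnorm1.
by move=> a b a1 b1; rewrite cnormM a1 b1 mulr1.
Qed.

(** A difference of squares of moduli is at most [d * (2 + d)]. *)
Lemma sqnorm_close z z' (d : R) : d <= 1 -> cnorm z' <= 1 ->
  cnorm (z - z') <= d -> `|sqnorm z - sqnorm z'| <= 3 * d.
Proof.
move=> d1 z1 zd; rewrite !cnorm_sqr.
have h1 : cnorm z <= cnorm z' + cnorm (z - z').
  by rewrite -{1}[z](subrK z') addrC cnormD.
have h2 : cnorm z' <= cnorm z + cnorm (z - z').
  by rewrite -{1}[z'](subrK z) addrC -(cnormN (z - z')) opprB cnormD.
have := cnorm_ge0 z; have := cnorm_ge0 z'; have := cnorm_ge0 (z - z').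
move: (cnorm _) (cnorm z) (cnorm z') d1 z1 zd h1 h2 => e a b d1 b1 ed h1 h2 e0 b0 a0.
rewrite ler_norml; nra.
Qed.

(** Hybrid argument: one factor is exchanged at a time, the exchanged ones being unimodular and the
    others of modulus at most [1 + eps]. *)
Lemma prod_close D (u e : 'I_D -> R[i]) (eps : R) : 0 <= eps ->
  (forall j, cnorm (e j) = 1) -> (forall j, cnorm (u j - e j) <= eps) ->
  cnorm (\prod_j u j - \prod_j e j) <= (1 + eps) ^+ D - 1.
Proof.
move=> eps0; elim: D u e => [|D IH] u e e1 ue.
  by rewrite !big_ord0 expr0 !subrr -[0]/(rC 0) cnorm_rC normr0.
rewrite !big_ord_recl exprS.
set U := \prod_(i < D) _; set E := \prod_(i < D) _.
have {IH}h : cnorm (U - E) <= (1 + eps) ^+ D - 1 by apply: IH => j.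
have -> : u ord0 * U - e ord0 * E =
   u ord0 * (U - E) + (u ord0 - e ord0) * E by ring.
apply: le_trans (cnormD _ _) _; rewrite !cnormM.
have -> : cnorm E = 1 by apply: cnorm_prod1.
have u1 : cnorm (u ord0) <= 1 + eps.
  rewrite -[u ord0](subrK (e ord0)) addrC; apply: le_trans (cnormD _ _) _.
  by rewrite e1 lerD2l.
have := ue ord0; have := cnorm_ge0 (U - E); have := cnorm_ge0 (u ord0).
move: (cnorm _) (cnorm _) (cnorm _) u1 h => a b c; nra.
Qed.

(** The smallness hypothesis absorbs the quadratic term [2 * D * eps ^+ 2] into [eps]. *)
Lemma expr1D_le (eps : R) D : 0 <= eps -> 2 * D%:R * eps <= 1 ->
  (1 + eps) ^+ D - 1 <= 2 * D%:R * eps.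
Proof.
move=> e0; elim: D => [|D IH]; first by rewrite expr0 subrr !mulr0 mul0r.
rewrite exprS -natr1 => h.
have D0 : 0 <= D%:R :> R by [].
have {}IH := IH ltac:(nra).
nra.
Qed.

Definition expi t : R[i] := Complex (cos t) (sin t).

Lemma expiD s t : expi (s + t) = expi s * expi t.
Proof. by rewrite /expi cosD sinD; apply: complexP; simpc => //=; ring. Qed.

Lemma expi0 : expi 0 = 1. Proof. by rewrite /expi cos0 sin0. Qed.

Lemma cnorm_expi t : cnorm (expi t) = 1.
Proof. by rewrite /cnorm /= cos2Dsin2 sqrtr1. Qed.

Lemma conjc_expi t : conjc (expi t) = expi (- t).
Proof. by rewrite /expi cosN sinN. Qed.

Lemma expi_sum (I : finType) (f : I -> R) : \prod_i expi (f i) = expi (\sum_i f i).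
Proof. by rewrite (big_morph _ expiD expi0). Qed.

Lemma expX_sym t a b : expX t a b = expX t b a.
Proof. by rewrite /expX eq_sym. Qed.

Let s2 : R := (Num.sqrt 2)^-1.

(** The Hadamard columns are eigenvectors of X, with [a = false] for plus and [a = true] for minus,
    so the rotation is a mere phase. *)
Lemma expX_hadamard t v a : \sum_c expX t c v * hadamard R c a =
  rC s2 * ((-1) ^+ (a * v) * expi ((-1) ^+ (~~ a) * t)).
Proof.
rewrite big_bool /expX /hadamard /iC /rC -/s2 /expi.
by case: a; case: v => /=; apply: complexP; simpc => /=;
  rewrite ?expr0 ?expr1 ?mulN1r ?mul1r ?cosN ?sinN /=; simpc => /=; ring.
Qed.

Definition Eamp th (a : bool) (w : nat) : R[i] :=
  (-1) ^+ (a * w) * expi ((-1) ^+ (~~ a) * (th * w%:R)).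

Lemma EampD th a w w' : Eamp th a (w + w') = Eamp th a w * Eamp th a w'.
Proof.
rewrite /Eamp mulnDr exprD natrD !mulrDr expiD; ring.
Qed.

Lemma Eamp0 th a : Eamp th a 0 = 1.
Proof. by rewrite /Eamp muln0 !mulr0 expi0 mulr1. Qed.

Lemma Eamp_sum th a (I : finType) (f : I -> nat) :
  \prod_i Eamp th a (f i) = Eamp th a (\sum_i f i)%N.
Proof. by rewrite (big_morph _ (EampD th a) (Eamp0 th a)). Qed.

Lemma cnorm_Eamp th a w : cnorm (Eamp th a w) = 1.
Proof. by rewrite cnormM cnorm_sign cnorm_expi mulr1. Qed.

(** The phases depend on the control bits, a cyclic shift of the string, so their product sees only
    the weight. *)
Lemma Mgate_hadamard m th (v : bits m) a :
  \sum_u Mgate th u v * \prod_k hadamard R (u k) a =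
  rC s2 ^+ m * Eamp th a (weight v).
Proof.
under eq_bigr do rewrite MgateE -big_split /=.
rewrite -(bigA_distr_bigA (fun k c =>
  expX (th * (v (ord_pred k))%:R) c (v k) * hadamard R c a)).
under eq_bigr do rewrite expX_hadamard.
rewrite big_split /= prodr_const card_ord big_split /=; congr (_ * (_ * _)).
  rewrite weightE big_distrr /= -prodrXr //.
rewrite expi_sum -mulr_sumr -mulr_sumr -natr_sum weightE.
rewrite [in RHS](reindex_inj (@ord_pred_inj m)) //.
Qed.

Definition uamp m th a (v : bits m) : R[i] :=
  if ~~ bitn v 0 then Eamp th a (weight v)
  else (Eamp th a (weight v) - gammaU th v * Eamp th a (weight (compl v)))
         / rC (Num.sqrt (1 - sqnorm (gammaU th v))).

Lemma conjc_hadamard a b : conjc (hadamard R a b) = hadamard R a b.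
Proof. exact: conjc_rC. Qed.

Lemma Ugate_hadamard m th (v : bits m) a :
  \sum_u conjc (Ugate th u v) * \prod_k hadamard R (u k) a =
  rC s2 ^+ m * conjc (uamp th a v).
Proof.
suff h : \sum_u Ugate th u v * \prod_k hadamard R (u k) a = rC s2 ^+ m * uamp th a v.
  rewrite -[in RHS]rCX -(conjc_rC (s2 ^+ m)) -(rmorphM (@conjc R)) rCX -h.
  rewrite rmorph_sum; apply: eq_bigr => u _; rewrite rmorphM rmorph_prod /=.
  by congr (_ * _); apply: eq_bigr => k _; exact/esym/conjc_hadamard.
rewrite /Ugate /uamp; case: ifP => _; first exact: Mgate_hadamard.
transitivity ((\sum_u Mgate th u v * \prod_k hadamard R (u k) a
  - gammaU th v * \sum_u Mgate th u (compl v) * \prod_k hadamard R (u k) a)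
   / rC (Num.sqrt (1 - sqnorm (gammaU th v)))).
  rewrite mulr_sumr -sumrB mulr_suml; apply: eq_bigr => u _; ring.
rewrite !Mgate_hadamard; ring.
Qed.

(** With [r] the normalising root, the difference is [((1 - r) E - gamma E') / r]; here
    [1 - r <= g], [|gamma| = g] and [r >= 1/2]. *)
Lemma uamp_close m th a (v : bits m) : `|sin th| ^+ m <= 2^-1 ->
  cnorm (uamp th a v - Eamp th a (weight v)) <= 4 * `|sin th| ^+ m.
Proof.
set g := `|sin th| ^+ m => g2; have g0 : 0 <= g by rewrite exprn_ge0.
rewrite /uamp; case: ifP => _.
  by rewrite subrr -[0]/(rC 0) cnorm_rC normr0 mulr_ge0.
rewrite sqnorm_gammaU -/g; set r := Num.sqrt _.
have r0 : 0 <= r by exact: sqrtr_ge0.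
have r2 : r ^+ 2 = 1 - g ^+ 2 by rewrite sqr_sqrtr //; nra.
have r1 : r <= 1 by nra.
have rg : 1 - g <= r by nra.
have rn0 : rC r != 0.
  rewrite (_ : 0 = rC 0) // (inj_eq rC_inj) gt_eqF //; lra.
set E := Eamp _ _ _; set E' := Eamp _ _ _; set ga := gammaU _ _.
have E1 : cnorm E = 1 by exact: cnorm_Eamp.
have E1' : cnorm E' = 1 by exact: cnorm_Eamp.
have gag : cnorm ga = g by apply: rC_inj; rewrite -cnormE norm_gammaU.
clearbody E E' ga.
have -> : (E - ga * E') / rC r - E = (rC (1 - r) * E - ga * E') * (rC r)^-1.
  by rewrite rCB (_ : rC 1 = 1) //; field.
have ri : (rC r)^-1 = rC r^-1 by exact/esym/(fmorphV (real_complex R)).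
rewrite ri cnormM cnorm_rC ger0_norm ?invr_ge0 // ler_pdivrMr; last by lra.
apply: le_trans (cnormD _ _) _; rewrite cnormN !cnormM E1 E1' gag !mulr1.
rewrite cnorm_rC ger0_norm; nra.
Qed.

End Amplitude.

(** * The output state *)

Section Blocks.
Set Implicit Arguments. Unset Strict Implicit. Unset Printing Implicit Defensive.
Variable R : realType.
Variables m D : nat.
Hypothesis m_gt0 : (0 < m)%N.
Implicit Types (th : R).

Lemma bitn_ffun k (F : 'I_k -> bool) i (ik : (i < k)%N) :
  bitn [ffun o => F o] i = F (Ordinal ik).
Proof. by rewrite /bitn insubT /= ffunE; congr F; apply: val_inj. Qed.

(** Only the last index has quotient [D], where [insub] fails and the bit [a] is used. *)
Definition unblk (f : {ffun 'I_D -> bits m}) (a : bool) : bits (D * m).+1 :=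
  [ffun i : 'I_(D * m).+1 =>
     if insub (i %/ m)%N is Some j then bitn (f j) (i %% m)%N else a].

Lemma block_lt (j : 'I_D) (k : 'I_m) : (j * m + k < D * m)%N.
Proof.
have : (j.+1 * m <= D * m)%N by rewrite leq_mul2r ltn_ord orbT.
have := ltn_ord k; rewrite mulSn; lia.
Qed.

Lemma blk_unblk f a (j : 'I_D) : blk m (unblk f a) j = f j.
Proof.
apply/ffunP => k; rewrite ffunE.
have lt : (j * m + k < (D * m).+1)%N by rewrite ltnS ltnW // block_lt.
rewrite bitn_ffun /= divnMDl // divn_small // addn0 modnMDl modn_small //.
by rewrite valK bitn_ord.
Qed.

Lemma last_unblk f a : bitn (unblk f a) (D * m) = a.
Proof. by rewrite bitn_ffun //= mulnK // insubF // ltnn. Qed.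

Lemma unblkK (y : bits (D * m).+1) :
  unblk [ffun j : 'I_D => blk m y j] (bitn y (D * m)) = y.
Proof.
apply/ffunP => i; rewrite ffunE; case: insubP => [j _ jE|].
  rewrite ffunE bitn_ffun ?ltn_pmod // => lt.
  by rewrite /= jE -divn_eq bitn_ord.
rewrite -leqNgt leq_divRL // => le.
have iE : i = (D * m)%N :> nat by apply/eqP; rewrite eqn_leq le -ltnS ltn_ord.
by rewrite -(bitn_ord y i) iE.
Qed.

Lemma sum_blocks (V : nmodType) (G : bits (D * m).+1 -> V) :
  \sum_y G y = \sum_f \sum_a G (unblk f a).
Proof.
rewrite pair_bigA /= (reindex (fun fa => unblk fa.1 fa.2)) //=.
exists (fun y : bits (D * m).+1 => ([ffun j : 'I_D => blk m y j], bitn y (D * m))).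
  move=> [f a] _ /=; rewrite last_unblk; congr pair.
  by apply/ffunP => j; rewrite ffunE blk_unblk.
by move=> y _; exact: unblkK.
Qed.

Lemma big_blocks (T : Type) (idx : T) (op : Monoid.com_law idx) (H : nat -> T) :
  \big[op/idx]_(i < D * m) H i =
  \big[op/idx]_(j < D) \big[op/idx]_(k < m) H (j * m + k)%N.
Proof.
rewrite -(big_mkord xpredT H) big_nat_mul big_mkord.
apply: eq_bigr => j _; rewrite -{1}[(j * m)%N]add0n big_addn mulSn addnK big_mkord.
by apply: eq_bigr => k _; rewrite addnC.
Qed.

Lemma prod_unblk (H : bool -> R[i]) f a :
  \prod_i H (unblk f a i) = (\prod_j \prod_k H (f j k)) * H a.
Proof.
transitivity (\prod_(i < (D * m).+1) H (bitn (unblk f a) i)).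
  by apply: eq_bigr => i _; rewrite bitn_ord.
rewrite big_ord_recr /= last_unblk; congr (_ * _).
rewrite (big_blocks _ (fun i => H (bitn (unblk f a) i))).
apply: eq_bigr => j _; apply: eq_bigr => k _.
by rewrite -[in RHS](blk_unblk f a) ffunE.
Qed.

Lemma weight_blocks (x : bits (D * m)) : weight x = (\sum_(j < D) weight (blk m x j))%N.
Proof.
rewrite weightE.
transitivity (\sum_(i < D * m) bitn x i)%N.
  by apply: eq_bigr => i _; rewrite bitn_ord.
rewrite (big_blocks _ (fun i => bitn x i : nat)); apply: eq_bigr => j _.
by rewrite weightE; apply: eq_bigr => k _; rewrite ffunE.
Qed.

Lemma blk_joinb (x : bits (D * m)) b (j : 'I_D) :
  blk m (@joinb (D * m).+1 x b) j = blk m x j.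
Proof.
apply/ffunP => k; rewrite !ffunE.
have lt := block_lt j k.
by rewrite (bitn_ffun _ (ltnW lt : (_ < (D * m).+1)%N)) /= lt.
Qed.

Lemma last_joinb (x : bits (D * m)) b : bitn (@joinb (D * m).+1 x b) (D * m) = b.
Proof. by rewrite bitn_ffun //= ltnn. Qed.

Let s2 : R := (Num.sqrt 2)^-1.

(** With at least one qubit the two strings in the GHZ state are distinct, and they give the two
    branches [a]. *)
Lemma hadamard_ghz n (y : bits n.+1) :
  applyg (@tens1 R n.+1 (hadamard R)) (@ghz R n.+1) y =
  rC s2 * \sum_a \prod_i hadamard R (y i) a.
Proof.
rewrite /applyg big_bool /=.
have ne : [ffun=> true] != [ffun=> false] :> bits n.+1.
  by apply/eqP => /ffunP/(_ ord0); rewrite !ffunE.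
rewrite (bigD1 [ffun=> true]) //= (bigD1 [ffun=> false]) /=; last by rewrite eq_sym.
rewrite big1 ?addr0 => [|x /andP[xt xf]].
  have g1 : ghz R ([ffun=> true] : bits n.+1) = rC s2.
    have h : [forall i, ([ffun=> true] : bits n.+1) i].
      by apply/forallP => i; rewrite ffunE.
    by rewrite /ghz h orbT div1r.
  have g0 : ghz R ([ffun=> false] : bits n.+1) = rC s2.
    rewrite /ghz (_ : [forall i, ~~ _] = true) ?div1r //.
    by apply/forallP => i; rewrite ffunE.
  rewrite g1 g0 mulrDr ![_ * rC s2]mulrC /tens1.
  by congr (_ * _ + _ * _); apply: eq_bigr => i _; rewrite ffunE.
rewrite /ghz; case: ifP => [/orP[] /forallP h|]; last by rewrite mulr0.
  by case/eqP: xf; apply/ffunP => i; rewrite ffunE; apply/negbTE/h.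
by case/eqP: xt; apply/ffunP => i; rewrite ffunE; apply/h.
Qed.

Definition block_amp th (x : bits (D * m)) (b : bool) : R[i] :=
  rC 2^-1 * \sum_a (\prod_(j < D) conjc (uamp th a (blk m x j)))
    * ((-1) ^+ (a * b) * expi ((-1) ^+ (~~ a) * (pi / 4))).

(** In each branch the input is a product state, so the sum over inputs distributes over the blocks.
    The last qubit and the GHZ normalisation supply the factor 1/2 in [block_amp]. *)
Lemma psiE p (x : bits (D * m)) b :
  psi R m D p (@joinb (D * m).+1 x b) =
  rC s2 ^+ (D * m) * block_amp (pi / p%:R) x b.
Proof.
rewrite /psi /applyg -/(applyg _ _).
under eq_bigr => y _ do rewrite -/(applyg (tens1 (hadamard R)) (@ghz R _) y) hadamard_ghz.
rewrite sum_blocks /block_amp.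
have s22 : rC s2 * rC s2 = rC 2^-1.
  by rewrite -rCM -expr2 exprVn sqr_sqrtr.
under eq_bigr do under eq_bigr do
  rewrite /blockop last_unblk last_joinb mulr_sumr mulr_sumr.
transitivity (\sum_a rC s2 *
    ((\prod_(j < D) \sum_u conjc (Ugate (pi / p%:R) u (blk m x j))
      * \prod_k hadamard R (u k) a) * \sum_c expX (pi / 4) b c * hadamard R c a)).
  under eq_bigr do rewrite exchange_big /=.
  rewrite exchange_big /=; apply: eq_bigr => a _.
  rewrite bigA_distr_bigA /= mulr_suml mulr_sumr; apply: eq_bigr => f _.
  rewrite mulr_sumr mulr_sumr; apply: eq_bigr => c _.
  rewrite (prod_unblk (fun v => hadamard R v a)) big_split /=.
  under eq_bigr do rewrite blk_unblk blk_joinb /adjoint.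
  ring.
rewrite mulrA mulr_sumr; apply: eq_bigr => a _.
under eq_bigr do rewrite Ugate_hadamard.
under [X in _ * (_ * X) = _]eq_bigr do rewrite expX_sym.
rewrite expX_hadamard big_split /= prodr_const card_ord -exprM mulnC -s22.
ring.
Qed.

Lemma Ppsi_block_amp p (z : bits (D * m) * bool) :
  @Ppsi R (D * m).+1 m D p z = 2 ^- (D * m) * sqnorm (block_amp (pi / p%:R) z.1 z.2).
Proof.
rewrite /Ppsi psiE !cnorm_sqr cnormM exprMn; congr (_ * _).
rewrite -rCX cnorm_rC ger0_norm ?exprn_ge0 ?invr_ge0 ?sqrtr_ge0 //.
by rewrite -exprM mulnC exprM exprVn sqr_sqrtr // exprVn.
Qed.

(** This is [block_amp] with every [uamp] replaced by [Eamp], that is, U replaced by M. *)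
Definition ideal_amp th (w : nat) (b : bool) : R[i] :=
  rC 2^-1 * \sum_a conjc (Eamp th a w)
    * ((-1) ^+ (a * b) * expi ((-1) ^+ (~~ a) * (pi / 4))).

Lemma sqnorm_two_phases (s al : R) : s ^+ 2 = 1 ->
  sqnorm (rC 2^-1 * (expi al + rC s * expi (- al))) = (1 + s * cos (al *+ 2)) / 2.
Proof.
move=> s1; rewrite /expi cosN sinN cos_mulr2n -mulr_natr /rC; simpc => /=.
have := cos2Dsin2 al; move: (cos al) (sin al) => c d cd.
have d2 : d ^+ 2 = 1 - c ^+ 2 by rewrite -cd; ring.
transitivity ((1 + s ^+ 2) * (c ^+ 2 + d ^+ 2) / 4 + s * (c ^+ 2 - d ^+ 2) / 2).
  by field.
by rewrite s1 cd d2; field.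
Qed.

(** The branches interfere with phases [al] and [- al], where [al = th * w - pi / 4]; the shift from
    the last-qubit rotation turns the cosine of [2 al] into a sine. *)
Lemma sqnorm_ideal_amp th w b :
  sqnorm (ideal_amp th w b) = (1 + (-1) ^+ (odd w (+) b) * sin (2 * th * w%:R)) / 2.
Proof.
have -> : sin (2 * th * w%:R) = cos ((th * w%:R - pi / 4) *+ 2).
  by rewrite -cosBpihalf; congr cos; rewrite -[_ *+ 2]mulr_natr; field.
rewrite -sqnorm_two_phases; last by rewrite -exprM mulnC exprM sqrrN expr1n expr1n.
congr (sqnorm (_ * _)); rewrite big_bool addrC.
have -> : Eamp th false w = expi (- (th * w%:R)).
  by rewrite /Eamp mul0n expr0 mul1r expr1 mulN1r.
have -> : Eamp th true w = (-1) ^+ w * expi (th * w%:R).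
  by rewrite /Eamp mul1n expr0 mul1r.
rewrite mul0n mul1n !expr0 expr1 !mul1r mulN1r conjc_expi opprK -expiD.
congr (_ + _).
rewrite (_ : conjc (_ * _) = conjc ((-1) ^+ w) * conjc (expi (th * w%:R)));
  last exact: rmorphM.
rewrite conjc_expi.
have -> : conjc ((-1) ^+ w) = (-1) ^+ w :> R[i].
  by rewrite (rmorphXn (@conjc R)) (rmorphN1 (@conjc R)).
have -> : rC ((-1) ^+ (odd w (+) b)) = (-1) ^+ w * (-1) ^+ b :> R[i].
  rewrite signr_addb signr_odd rCM !rCX; congr (_ ^+ _ * _ ^+ _).
    exact: (rmorphN1 (real_complex R)).
  exact: (rmorphN1 (real_complex R)).
rewrite (_ : - (th * w%:R - pi / 4) = - (th * w%:R) + pi / 4); last by ring.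
rewrite expiD; ring.
Qed.

Lemma cnorm_ideal_amp th w b : cnorm (ideal_amp th w b) <= 1.
Proof.
rewrite /ideal_amp cnormM cnorm_rC ger0_norm ?invr_ge0 // ler_pdivrMl // big_bool mulr1.
apply: le_trans (cnormD _ _) _.
rewrite !cnormM !cnormJ !cnorm_Eamp !cnorm_sign !cnorm_expi; lra.
Qed.

(** Each branch is a product of [D] block amplitudes, each off by at most [4 g]; the factor 1/2
    averages the two branches. *)
Lemma block_amp_close th (x : bits (D * m)) b :
  `|sin th| ^+ m <= 2^-1 -> 8 * D%:R * `|sin th| ^+ m <= 1 ->
  cnorm (block_amp th x b - ideal_amp th (weight x) b) <= 8 * D%:R * `|sin th| ^+ m.
Proof.
set g := `|sin th| ^+ m => g2 Dg.
have g0 : 0 <= g by rewrite exprn_ge0.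
rewrite /block_amp /ideal_amp -mulrBr -sumrB cnormM cnorm_rC ger0_norm ?invr_ge0 //.
rewrite ler_pdivrMl //.
have h a : cnorm ((\prod_(j < D) conjc (uamp th a (blk m x j)))
    * ((-1) ^+ (a * b) * expi ((-1) ^+ (~~ a) * (pi / 4)))
  - conjc (Eamp th a (weight x)) * ((-1) ^+ (a * b) * expi ((-1) ^+ (~~ a) * (pi / 4))))
  <= 8 * D%:R * g.
  rewrite -mulrBl cnormM (cnormM ((-1) ^+ _)) cnorm_sign cnorm_expi !mulr1.
  rewrite weight_blocks -Eamp_sum rmorph_prod.
  have e4 : 0 <= 4 * g by rewrite mulr_ge0.
  apply: le_trans (prod_close e4 _ _) _ => [j|j|].
  - by rewrite cnormJ cnorm_Eamp.
  - by rewrite -(rmorphB (@conjc R)) cnormJ uamp_close.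
  - apply: le_trans (expr1D_le e4 _) _; lra.
rewrite big_bool; apply: le_trans (cnormD _ _) _.
have := h true; have := h false; lra.
Qed.

End Blocks.

(** * Total variation distance *)

Section Distance.
Set Implicit Arguments. Unset Strict Implicit. Unset Printing Implicit Defensive.
Variable R : realType.

(** On the target bit the ideal probability falls short of [2 ^- N] by this amount, and on the other
    bit it exceeds 0 by the same amount. *)
Lemma ideal_target_dist p N (x : bits N) b :
  `|2 ^- N * sqnorm (ideal_amp (pi / p%:R : R) (weight x) b) - @Qtarget R N.+1 p (x, b)|
  = 2 ^- N * ((1 - signed_sin R p (weight x)) / 2).
Proof.
have N0 : 0 < 2 ^- N :> R by rewrite invr_gt0 exprn_gt0.
rewrite sqnorm_ideal_amp /Qtarget /= /majmod -/(majmodn p (weight x)) /parity div1r.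
have := signed_sin_max R p (weight x); rewrite /signed_sin.
move: (sin _) => S; move: (2 ^- N) N0 => q q0.
case: (majmodn _ _); case: (odd _); case: b => /=;
  rewrite ?expr0 ?expr1 ?mul1r ?mulN1r ?normrN => /ler_normlP[h1 h2].
all: match goal with |- `|?u| = ?v =>
    first [have e : u = v by field | have e : u = - v by field];
    rewrite e ?normrN ger0_norm //; nra
  end.
Qed.

(** The triangle inequality through the ideal distribution; both values of [b] contribute equally,
    which cancels the half in [tvdist]. *)
Lemma tvdist_le m D p : (0 < m)%N ->
  `|sin (pi / p%:R : R)| ^+ m <= 2^-1 ->
  8 * D%:R * `|sin (pi / p%:R : R)| ^+ m <= 1 ->
  tvdist (@Ppsi R (D * m).+1 m D p) (@Qtarget R (D * m).+1 p) <=
  2^-1 - 2^-1 * (2 ^- (D * m) * \sum_(x : bits (D * m)) signed_sin R p (weight x))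
   + 3 * (8 * D%:R * `|sin (pi / p%:R : R)| ^+ m).
Proof.
move=> m0; set th := pi / p%:R; set g := `|sin th| ^+ m => g2 Dg.
set N := (D * m)%N; set d := 8 * D%:R * g.
have q0 : 0 < 2 ^- N :> R by rewrite invr_gt0 exprn_gt0.
have pt (z : bits N * bool) : `|@Ppsi R N.+1 m D p z - @Qtarget R N.+1 p z| <=
   2 ^- N * (3 * d + (1 - signed_sin R p (weight z.1)) / 2).
  case: z => x b /=; rewrite Ppsi_block_amp // mulrDr -(ideal_target_dist p x b) -/th -/N.
  set P0 := 2 ^- N * sqnorm (ideal_amp _ _ _); set P := 2 ^- N * _.
  rewrite -[P](subrK P0) -addrA; apply: le_trans (ler_normD _ _) _.
  rewrite lerD2r /P /P0 -mulrBr normrM gtr0_norm // ler_pM2l //.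
  apply: sqnorm_close => //; first exact: cnorm_ideal_amp.
  exact: block_amp_close.
have two : 2 ^- N * (2 ^ N)%:R = 1 :> R.
  by rewrite natrX mulVf // expf_neq0 // pnatr_eq0.
apply: (@le_trans _ _ (2^-1 * \sum_(z : bits N * bool)
   2 ^- N * (3 * d + (1 - signed_sin R p (weight z.1)) / 2))).
  by rewrite ler_pM2l ?invr_gt0 //; apply: ler_sum => z _; exact: pt.
rewrite -(pair_bigA _ (fun x (b : bool) =>
  2 ^- N * (3 * d + (1 - signed_sin R p (weight x)) / 2))) /=.
under eq_bigr do rewrite big_bool /=.
have -> : \sum_(x : bits N) (2 ^- N * (3 * d + (1 - signed_sin R p (weight x)) / 2)
     + 2 ^- N * (3 * d + (1 - signed_sin R p (weight x)) / 2))
  = 2 ^- N * (2 ^ N)%:R * (6 * d + 1)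
    - 2 ^- N * \sum_(x : bits N) signed_sin R p (weight x).
  rewrite -mulrA [(2 ^ N)%:R * _]mulr_natl.
  have -> : (6 * d + 1) *+ 2 ^ N = \sum_(x : bits N) (6 * d + 1).
    by rewrite sumr_const card_ffun card_bool card_ord.
  rewrite -mulrBr -sumrB mulr_sumr; apply: eq_bigr => x _.
  by rewrite -mulrDr; congr (_ * _); field.
rewrite two; lra.
Qed.

(** * Growth of [p] against [n], and decay of the equidistribution error *)

Lemma powR_lower_bound (c c1 : R) n p k : 0 < c1 -> (0 < n)%N ->
  c1 * n%:R `^ c <= p%:R -> 1 <= c * k%:R -> c1 ^+ k * n%:R <= p%:R ^+ k :> R.
Proof.
move=> c10 n0 h ck.
have n1 : 1 <= n%:R :> R by rewrite ler1n.
apply: (@le_trans _ _ ((c1 * n%:R `^ c) ^+ k)); last first.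
  by apply: lerXn2r; rewrite ?nnegrE // mulr_ge0 ?powR_ge0 // ltW.
rewrite exprMn ler_pM2l ?exprn_gt0 // -powR_mulrn ?powR_ge0 // -powRrM.
exact: le1r_powR.
Qed.

Lemma powR_upper_bound (c c2 : R) n p j k : 0 < c2 -> (0 < n)%N ->
  p%:R <= c2 * n%:R `^ c -> c * j%:R <= k%:R ->
  p%:R ^+ j <= c2 ^+ j * n%:R ^+ k :> R.
Proof.
move=> c20 n0 h ck.
have n1 : 1 <= n%:R :> R by rewrite ler1n.
apply: (@le_trans _ _ ((c2 * n%:R `^ c) ^+ j)).
  by apply: lerXn2r; rewrite ?nnegrE // mulr_ge0 ?powR_ge0 // ltW.
rewrite exprMn ler_pM2l ?exprn_gt0 // -(powR_mulrn j (powR_ge0 _ _)) -powRrM.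
by rewrite -(powR_mulrn k (ler0n R n)) ler_powR.
Qed.

(** With [y = a * N], the power of [1 - a] is at most [exp (- y)], while the Taylor series bounds
    [y ^+ k.+1] by [(k.+1)! * exp y]. *)
Lemma expr1B_le (a : R) N k : 0 <= a <= 1 ->
  (1 - a) ^+ N * (a * N%:R) ^+ k.+1 <= (k.+1)`!%:R.
Proof.
move=> /andP[a0 a1].
have h1 : (1 - a) ^+ N <= (expR (a * N%:R))^-1.
  rewrite expRM_natr -exprVn -expRN; apply: lerXn2r; rewrite ?nnegrE ?expR_ge0 //.
    by rewrite subr_ge0.
  exact: expR_ge1Dx.
have y0 : 0 <= a * N%:R by rewrite mulr_ge0.
have := expR_ge1Dxn k y0; set y := a * N%:R in h1 y0 *; set f := (k.+1)`!%:R.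
have f0 : 0 < f :> R by rewrite ltr0n fact_gt0.
have E0 : 0 < expR y by exact: expR_gt0.
move=> h2; have h3 : y ^+ k.+1 <= f * expR y.
  rewrite mulrC -ler_pdivrMr //; lra.
have : (1 - a) ^+ N * y ^+ k.+1 <= (expR y)^-1 * (f * expR y).
  by apply: ler_pM; rewrite ?exprn_ge0 ?subr_ge0.
by rewrite mulrCA mulVf ?mulr1 // gt_eqF.
Qed.

(** The contraction over [n - 1] steps is of order [(p^2 / n)^(k+1)]. The hypothesis on [k] makes
    this [O(p^-3)], so the squared error, which carries a factor [4 p], is [O(p^-2)]. *)
Lemma mean_signed_sin_lower (c c2 : R) k : 0 < c2 ->
  c * (2 * k.+1 + 3)%:R <= k.+1%:R ->
  exists2 K : R, 0 < K & forall n p, (1 < n)%N -> odd p -> (2 < p)%N ->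
    p%:R <= c2 * n%:R `^ c ->
    2 / pi - K / p%:R <=
      2 ^- n.-1 * \sum_(x : bits n.-1) signed_sin R p (weight x).
Proof.
move=> c20 ck.
pose Q : R := 4 * ((k.+1)`!%:R * 8 ^+ k.+1 * c2 ^+ (2 * k.+1 + 3)).
have Q0 : 0 <= Q by rewrite !mulr_ge0 ?exprn_ge0 // ltW.
(* One unit pays for the mean over a period, and [1 + Q] bounds the square root of [Q]. *)
exists (2 + Q); first by lra.
move=> n p n1 op p2 pn.
have pp : 2 < p%:R :> R by rewrite ltr_nat.
have pp0 : 0 < p%:R :> R by lra.
have pi0 : 0 < p%:R^-1 :> R by rewrite invr_gt0.
have nn : 0 < n%:R :> R by rewrite ltr0n ltnW.
pose a : R := (4 * p%:R ^+ 2)^-1.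
have a0 : 0 < a by rewrite invr_gt0 mulr_gt0 // exprn_gt0 //; lra.
have a1 : a <= 1 by rewrite invf_le1 //; nra.
have p0 : (0 < p)%N by exact: ltn_trans p2.
have := mean_weight_close n.-1 p0 (signed_sin_periodic R p0) (signed_sin_max R p).
have := mean_signed_sin_ge R op p2.
set mu := p%:R^-1 * \sum_(r < p) _; set E := 2 ^- n.-1 * _.
rewrite -/a expr1n mulr1 => mu_ge E_close.
suff main : (1 - a) ^+ n.-1 * (4 * p%:R) <= Q * (p%:R^-1) ^+ 2.
  have : (E - mu) ^+ 2 <= Q * p%:R^-1 ^+ 2 by apply: le_trans E_close main.
  move: (p%:R^-1) pi0 mu_ge => q q0 mu_ge h.
  rewrite leNgt; apply/negP => lt.
  have : (1 + Q) * q < mu - E by nra.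
  have : 0 <= Q * q by nra.
  nra.
(* The 8 is the 4 in [a] doubled, since [n - 1 >= n / 2]. *)
have an : n%:R / (8 * p%:R ^+ 2) <= a * n.-1%:R.
  have p40 : 0 < 4 * p%:R ^+ 2 :> R by rewrite mulr_gt0 // exprn_gt0.
  rewrite /a ler_pdivlMl //.
  have -> : 4 * p%:R ^+ 2 * (n%:R / (8 * p%:R ^+ 2)) = n%:R / 2 :> R.
    by field; rewrite pnatr_eq0 -lt0n.
  rewrite ler_pdivrMr // -natrM ler_nat; move: n1; clear; lia.
have B := powR_upper_bound c20 (ltnW n1) pn ck.
have h1 : (1 - a) ^+ n.-1 * (n%:R / (8 * p%:R ^+ 2)) ^+ k.+1 <= (k.+1)`!%:R.
  apply: le_trans (@expr1B_le a n.-1 k _); last by rewrite (ltW a0).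
  apply: ler_wpM2l; first by rewrite exprn_ge0 // subr_ge0.
  apply: lerXn2r; rewrite ?nnegrE //.
    by rewrite divr_ge0 // mulr_ge0 // exprn_ge0.
  by rewrite mulr_ge0 // ltW.
have pk : 0 < p%:R ^+ k.+1 :> R by rewrite exprn_gt0 //; lra.
have nk : 0 < n%:R ^+ k.+1 :> R by rewrite exprn_gt0.
have h2 : (1 - a) ^+ n.-1 * n%:R ^+ k.+1 <=
    (k.+1)`!%:R * 8 ^+ k.+1 * p%:R ^+ (2 * k.+1).
  move: h1; rewrite expr_div_n mulrA ler_pdivrMr; last first.
    by rewrite exprn_gt0 // mulr_gt0 // exprn_gt0 //; lra.
  by rewrite exprMn -exprM mulrA.
rewrite -[leRHS]/(Q * p%:R^-1 ^+ 2) exprVn ler_pdivlMr; last by rewrite exprn_gt0 //; lra.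
rewrite -(ler_pM2r nk).
have -> : (1 - a) ^+ n.-1 * (4 * p%:R) * p%:R ^+ 2 * n%:R ^+ k.+1 =
  (1 - a) ^+ n.-1 * n%:R ^+ k.+1 * (4 * p%:R ^+ 3) by ring.
apply: (@le_trans _ _ ((k.+1)`!%:R * 8 ^+ k.+1 * p%:R ^+ (2 * k.+1) * (4 * p%:R ^+ 3))).
  by apply: ler_wpM2r h2; rewrite mulr_ge0 // exprn_ge0.
have -> : (k.+1)`!%:R * 8 ^+ k.+1 * p%:R ^+ (2 * k.+1) * (4 * p%:R ^+ 3) =
   4 * ((k.+1)`!%:R * 8 ^+ k.+1) * p%:R ^+ (2 * k.+1 + 3) :> R.
  by rewrite exprD; ring.
have -> : Q * n%:R ^+ k.+1 = 4 * ((k.+1)`!%:R * 8 ^+ k.+1) *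
   (c2 ^+ (2 * k.+1 + 3) * n%:R ^+ k.+1) by rewrite /Q; ring.
by apply: ler_wpM2l B; rewrite !mulr_ge0 // exprn_ge0.
Qed.

End Distance.

(** * Size of the block errors and threshold on [n] *)

Section ErrorBound.
Set Implicit Arguments. Unset Strict Implicit. Unset Printing Implicit Defensive.
Variable R : realType.

Lemma sin_pi_div_le p : (0 < p)%N -> `|sin (pi / p%:R : R)| <= 4 / p%:R.
Proof.
move=> p0; have p1 : 1 <= p%:R :> R by rewrite ler1n.
have pi0 := pi_gt0 R; have pi4 : pi < 4 :> R by have := pihalf_lt2 R; lra.
have x0 : 0 <= pi / p%:R :> R by rewrite divr_ge0 // ltW.
have s0 : 0 <= sin (pi / p%:R : R).
  apply: sin_ge0_pi; rewrite x0 /= ler_pdivrMr; last by lra.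
  by rewrite ler_peMr // ltW.
rewrite ger0_norm //; apply: le_trans (sin_le_id x0) _.
by rewrite ler_pM2r ?invr_gt0 ?ltr0n // ltW.
Qed.

(* The blocks are long enough for the n / m <= n block errors, each of order
   p ^- m, to add up to O(1/p), because p ^+ (m - 1) is at least of order n. *)
Lemma total_block_error (c c1 : R) m n p D : 0 < c1 -> (0 < n)%N -> (0 < p)%N ->
  c1 * n%:R `^ c <= p%:R -> 1 <= c * m%:R -> (D <= n)%N ->
  8 * D%:R * `|sin (pi / p%:R : R)| ^+ m.+1 <= 8 * 4 ^+ m.+1 / c1 ^+ m / p%:R.
Proof.
move=> c10 n0 p0 pn cm Dn.
have P := powR_lower_bound c10 n0 pn cm.
have pp : 0 < p%:R :> R by rewrite ltr0n.
have cm0 : 0 < c1 ^+ m by rewrite exprn_gt0.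
rewrite ler_pdivlMr // ler_pdivlMr //.
have g : `|sin (pi / p%:R : R)| ^+ m.+1 <= (4 / p%:R) ^+ m.+1.
  by apply: lerXn2r; rewrite ?nnegrE ?divr_ge0 // sin_pi_div_le.
apply: (@le_trans _ _ (8 * n%:R * (4 / p%:R) ^+ m.+1 * p%:R * c1 ^+ m)).
  rewrite ler_pM2r // ler_pM2r //; apply: ler_pM; rewrite ?mulr_ge0 ?exprn_ge0 //.
  by rewrite ler_pM2l // ler_nat.
have -> : 8 * n%:R * (4 / p%:R) ^+ m.+1 * p%:R * c1 ^+ m =
   8 * 4 ^+ m.+1 * (c1 ^+ m * n%:R / p%:R ^+ m).
  by rewrite expr_div_n !exprS; field; rewrite ?expf_neq0 gt_eqF.
rewrite -[leRHS]mulr1 ler_pM2l ?mulr_gt0 ?exprn_gt0 //.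
by rewrite ler_pdivrMr ?exprn_gt0 // mul1r.
Qed.

Lemma powR_ge_of_large (c y : R) : 0 < c -> exists n0, forall n,
  (n0 <= n)%N -> y <= n%:R `^ c.
Proof.
(* Clipping at 0 makes [z] the [c]-th power of its own root. *)
move=> c0; pose z : R := Num.max y 0.
have z0 : 0 <= z by rewrite le_max lexx orbT.
exists (Num.truncn (z `^ c^-1)).+1 => n nn.
apply: (@le_trans _ _ z); first by rewrite le_max lexx.
have <- : (z `^ c^-1) `^ c = z by rewrite -powRrM mulVf ?gt_eqF // powRr1.
apply: ge0_ler_powR; rewrite ?nnegrE ?powR_ge0 ?(ltW c0) //.
apply: le_trans (ltW (truncnS_gt _)) _; by rewrite ler_nat.
Qed.

End ErrorBound.

Theorem theorem4p11 (R : realType) (c c1 c2 : R) :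
  0 < c -> c < 2^-1 -> 0 < c1 -> c1 <= c2 ->
  exists (C : R) (n0 : nat), 0 < C /\
    forall (m n D p : nat),
      (m : int) = Num.ceil (c^-1 + 1) ->
      (n0 <= n)%N -> (m %| n - 1)%N -> D = ((n - 1) %/ m)%N ->
      prime p -> c1 * n%:R `^ c <= p%:R -> p%:R <= c2 * n%:R `^ c ->
      @unitary R m (@Ugate R m (pi / p%:R)) /\
      @tvdist R _ (@Ppsi R n m D p) (@Qtarget R n p)
        <= 2^-1 - pi^-1 + C / p%:R.
Proof.
move=> c0 c2' c10 c12.
have c20 : 0 < c2 by exact: lt_le_trans c12.
have [k ck] : exists k, c * (2 * k.+1 + 3)%:R <= k.+1%:R.
  (* Solving the inequality for [k.+1] gives this threshold, positive because [c < 1/2]. *)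
  exists (Num.truncn (3 * c / (1 - 2 * c))).
  have := truncnS_gt (3 * c / (1 - 2 * c)); set k := (Num.truncn _).+1.
  rewrite ltr_pdivrMr; last by lra.
  rewrite natrD natrM; lra.
have [K K0 HK] := mean_signed_sin_lower c20 ck.
(* One less than the block length, which still satisfies [c * m' >= 1]. *)
pose m' := `|Num.ceil (c^-1 + 1)|%N.-1.
pose K1 : R := 8 * 4 ^+ m'.+1 / c1 ^+ m'.
have K10 : 0 < K1 by rewrite divr_gt0 ?mulr_gt0 ?exprn_gt0.
(* This forces [p >= 8 + K1], so that [p] is odd, [sin (pi / p) <= 4 / p <= 1/2] and the total block
   error [K1 / p] is at most 1. *)
have [n0 Hn0] := powR_ge_of_large ((8 + K1) / c1) c0.
(* Half of [K] comes from the halved mean and [3 * K1] from the block errors in [tvdist_le]; the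
   shift by 2 gives [n > 1]. *)
exists (K / 2 + 3 * K1), n0.+2; split; first lra.
move=> m n D p mE nn0 mn DE pr_p pn1 pn2.
have n2 : (1 < n)%N by exact: leq_trans nn0.
have p_large : 8 + K1 <= p%:R.
  apply: le_trans pn1; rewrite mulrC -ler_pdivrMr //.
  by apply: Hn0; apply: leq_trans nn0; rewrite -addn2 leq_addr.
have m_ge : c^-1 + 1 <= m%:R by have := ceil_ge (c^-1 + 1); rewrite -mE.
have ci0 : 0 < c^-1 by rewrite invr_gt0.
have m0 : (0 < m)%N by rewrite -(ltr0n R); lra.
have mm' : m = m'.+1 by rewrite /m' -mE /= prednK.
have cm' : 1 <= c * m'%:R.
  by move: m_ge; rewrite mm' -natr1 lerD2r -ler_pdivrMl // mulr1.
have nE : n = (D * m).+1 by rewrite DE divnK // subn1 prednK // ltnW.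
have p8 : (8 <= p)%N by rewrite -(ler_nat R); lra.
have p0 : (0 < p)%N by exact: prime_gt0.
have pp : 0 < p%:R :> R by rewrite ltr0n.
have p2 : (2 < p)%N by exact: leq_trans p8.
have op : odd p by case: (boolP (odd p)) => // /(prime_oddPn pr_p) pE; rewrite pE in p2.
have sin_le : `|sin (pi / p%:R : R)| <= 2^-1.
  apply: le_trans (sin_pi_div_le R p0) _; rewrite ler_pdivrMr //; lra.
split; first by apply: Ugate_unitary => //; lra.
have g2 : `|sin (pi / p%:R : R)| ^+ m <= 2^-1.
  apply: le_trans sin_le; rewrite mm' exprS ler_piMr // exprn_ile1 //.
  exact: sin_max.
have Dn : (D <= n)%N by rewrite nE (leq_trans (leq_pmulr D m0)).
have err : 8 * D%:R * `|sin (pi / p%:R : R)| ^+ m <= K1 / p%:R.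
  by rewrite mm'; exact: total_block_error (ltnW n2) p0 pn1 cm' Dn.
have K1p : K1 / p%:R <= 1 by rewrite ler_pdivrMr //; lra.
have := HK n p n2 op p2 pn2.
rewrite nE /= => mean.
apply: le_trans (tvdist_le m0 g2 (le_trans err K1p)) _.
rewrite mulrDl; lra.
Qed.
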